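(* Let $H_1$ and $H_2$ be separable Hilbert spaces, and let $\{f_n\}_{n\in\mathbb{N}}\subset H_1$ and $\{g_m\}_{m\in\mathbb{N}}\subset H_2$ be two sequences. Then $\{f_n\otimes g_m\}_{n,m\in\mathbb{N}}\subset H_1\otimes H_2$ is a Riesz-Fischer sequence for $H_1\otimes H_2$ if and only if $\{f_n\}_{n\in\mathbb{N}}$ and $\{g_m\}_{m\in\mathbb{N}}$ are Riesz-Fischer sequences for $H_1$ and $H_2$ respectively.
   Context: $H_1\otimes H_2$ is the Hilbert space tensor product, i.e. the completion of the algebraic tensor product with respect to $\langle f_1\otimes g_1,f_2\otimes g_2\rangle=\langle f_1,f_2\rangle_{H_1}\langle g_1,g_2\rangle_{H_2}$. A countable sequence $\{f_n\}$ in a Hilbert space $H$ is a Riesz-Fischer sequence for $H$ if there is a constant $A>0$ such that $A\sum_n|c_n|^2\le\|\sum_n c_nf_n\|^2$ for all finite (finitely supported) scalar sequences $\{c_n\}$. *)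

(* Defs.v *)
From HB Require Import structures.
From mathcomp Require Import all_boot all_order all_algebra.
From mathcomp Require Import sesquilinear complex.
From mathcomp Require Import boolp classical_sets functions cardinality fsbigop.
From mathcomp Require Import reals topology normedtype.

Set Implicit Arguments.
Unset Strict Implicit.
Unset Printing Implicit Defensive.

Import Order.TTheory GRing.Theory Num.Theory.
Import numFieldNormedType.Exports.

Local Open Scope classical_set_scope.
Local Open Scope ring_scope.

(* Hilbert spaces are over the real or the complex numbers; [conj] is the
   identity in the first case and complex conjugation in the second. *)
Inductive real_or_complex (R : realType) :
    forall K : numFieldType, involutive_rmorphism K -> Prop :=
| RealScalars : @real_or_complex R R idfun
| ComplexScalars : @real_or_complex R R[i] Num.conj.

(* [{dot H for conj}] is the type of positive definite forms that are linear
   in the first argument, conjugate-linear in the second, and Hermitian. *)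
HB.mixin Record NormedModule_hasInner (K : numFieldType) (conj : K -> K) H
    of NormedModule K H := {
  inner : {dot H for conj};
  sqr_norm_inner : forall x : H, `|x| ^+ 2 = inner x x
}.

#[short(type="hilbertType")]
HB.structure Definition Hilbert (K : numFieldType) (conj : K -> K) :=
  {H of CompleteNormedModule K H & NormedModule_hasInner K conj H}.

Definition separable (T : topologicalType) : Prop :=
  exists2 D : set T, countable D & dense D.

(* The lower bound [A] is a scalar; [0 < A] forces it to be real. *)
Definition riesz_fischer (K : numFieldType) (H : normedModType K)
    (I : countType) (f : I -> H) : Prop :=
  exists2 A : K, 0 < A &
    forall c : I -> K, finite_set [set i | c i != 0] ->
      A * (\sum_(i \in [set: I]) `|c i| ^+ 2) <=
      `|\sum_(i \in [set: I]) c i *: f i| ^+ 2.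

(* Universal property of the algebraic tensor product of vector spaces. *)
Definition algebraic_tensor_product (K : fieldType) (U V T : lmodType K)
    (t : {bilinear U -> V -> T}) : Prop :=
  forall (W : lmodType K) (b : {bilinear U -> V -> W}),
    exists2 h : {linear T -> W}, (forall u v, h (t u v) = b u v) &
      forall h' : {linear T -> W}, (forall u v, h' (t u v) = b u v) -> h' =1 h.

(* A completion of the algebraic tensor product [algtensor] of [H1] and [H2]
   for the inner product [algdot]: a Hilbert space in which [algtensor] embeds
   isometrically with dense range.  Such a completion is unique up to
   isometric isomorphism. *)
Record hilbertTensor (K : numFieldType) (conj : K -> K)
    (H1 H2 : hilbertType conj) := HilbertTensor {
  algtensor : lmodType K;
  algtens : {bilinear H1 -> H2 -> algtensor};
  algtensP : algebraic_tensor_product algtens;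
  algdot : {dot algtensor for conj};
  algdot_tens : forall (f1 f2 : H1) (g1 g2 : H2),
    algdot (algtens f1 g1) (algtens f2 g2) = inner f1 f2 * inner g1 g2;
  completed :> hilbertType conj;
  embed : {linear algtensor -> completed};
  embed_isometric : forall x y : algtensor,
    inner (embed x) (embed y) = algdot x y;
  embed_dense : dense (range embed)
}.

Definition tens (K : numFieldType) (conj : K -> K) (H1 H2 : hilbertType conj)
    (H12 : hilbertTensor H1 H2) (f : H1) (g : H2) : H12 :=
  embed H12 (algtens H12 f g).

(* Main.v *)
Require Import Defs.
From HB Require Import structures.
From mathcomp Require Import all_boot all_order all_algebra.
From mathcomp Require Import sesquilinear complex.
From mathcomp Require Import boolp classical_sets functions cardinality fsbigop.
From mathcomp Require Import reals topology normedtype.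

Set Implicit Arguments.
Unset Strict Implicit.
Unset Printing Implicit Defensive.

(* If {f_n} and {g_m} satisfy the lower bounds A and B, orthogonalize finitely
   many g_m as g_m = sum_k b_mk e_k.  With d_nk = sum_m c_nm b_mk,
     |sum c_nm f_n (x) g_m|^2 = sum_k |sum_n d_nk f_n|^2 |e_k|^2
       >= A sum_n sum_k |d_nk|^2 |e_k|^2 = A sum_n |sum_m c_nm g_m|^2
       >= A B sum |c_nm|^2.
   Conversely, fixing m = 0 shows that A / |g_0|^2 is a bound for {f_n};
   g_0 is nonzero because A <= |f_0|^2 |g_0|^2. *)

Import Order.TTheory GRing.Theory Num.Theory.
Import numFieldNormedType.Exports.

Local Open Scope classical_set_scope.
Local Open Scope ring_scope.

(** * Orthogonal families in a Hilbert space *)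

Section Orthogonality.
Variables (K : numFieldType) (conj : involutive_rmorphism K).
Implicit Type H : hilbertType conj.

Lemma inner_eq0C H (x y : H) : inner x y = 0 -> inner y x = 0.
Proof. by move=> xy; rewrite hermC /= xy rmorph0 mulr0. Qed.

(** Pythagoras: only the diagonal terms of the expanded inner product survive. *)
Lemma sqr_norm_sum H n (u : 'I_n -> H) :
  (forall i j, i != j -> inner (u i) (u j) = 0) ->
  `|\sum_i u i| ^+ 2 = \sum_i `|u i| ^+ 2.
Proof.
move=> ortho; rewrite sqr_norm_inner linear_sumlz; apply: eq_bigr => i _.
rewrite linear_sumr (bigD1 i) //= big1 ?addr0 ?sqr_norm_inner // => j ji.
by rewrite ortho // eq_sym.
Qed.

Lemma sqr_norm_sumZ H n (a : 'I_n -> K) (e : 'I_n -> H) :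
  (forall i j, i != j -> inner (e i) (e j) = 0) ->
  `|\sum_i a i *: e i| ^+ 2 = \sum_i `|a i| ^+ 2 * `|e i| ^+ 2.
Proof.
move=> ortho; rewrite sqr_norm_sum => [|i j ij].
  by apply: eq_bigr => i _; rewrite normrZ exprMn.
by rewrite linearZl_LR linearZr_LR /= ortho // !mulr0.
Qed.

(** Induction on [n]: the new vector is [g n] minus its projections on the earlier ones. The [e i]
    are not normalized and some may vanish, so [g] may be linearly dependent. *)
Lemma gram_schmidt H (g : nat -> H) n :
  exists (e : 'I_n -> H) (b : nat -> 'I_n -> K),
    (forall i j, i != j -> inner (e i) (e j) = 0) /\
    (forall m, (m < n)%N -> g m = \sum_k b m k *: e k).
Proof.
elim: n => [|n [e [b [ortho gE]]]].
  by exists (fun=> 0), (fun _ _ => 0); split=> // -[].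
(* if [e k = 0] this coefficient is 0, since division by 0 gives 0 *)
pose a k := inner (g n) (e k) / inner (e k) (e k).
pose r := g n - \sum_k a k *: e k.
have rP k : inner r (e k) = 0.
  rewrite linearBl linear_sumlz (bigD1 k) //= big1 ?addr0 => [|j jk].
    rewrite linearZl_LR /=; have [->|ek0] := eqVneq (e k) 0.
      by rewrite !linear0r mulr0 subrr.
    by rewrite divfK ?subrr // -sqr_norm_inner expf_neq0 ?normr_eq0.
  by rewrite linearZl_LR /= ortho // mulr0.
(* [unlift ord_max] is [None] exactly at the last index, which carries the new vector [r]. Row [n]
   of [b'] is [a] followed by 1; every other row gets 0 there. *)
pose e' i := oapp e r (unlift ord_max i).
pose b' m i :=
  if m == n then oapp a 1 (unlift ord_max i) else oapp (b m) 0 (unlift ord_max i).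
exists e', b'; split=> [i j|m].
  rewrite /e'; case: unliftP => [i'|] ->; case: unliftP => [j'|] -> //=.
  - by rewrite (inj_eq lift_inj); exact: ortho.
  - by move=> _; apply: inner_eq0C.
  - by rewrite eqxx.
(* [big_ord_recr] indexes the old vectors by [widen_ord], while [e'] and [b'] recognize them through
   [lift ord_max]; the two embeddings agree. *)
have liftE (k : 'I_n) : unlift ord_max (widen_ord (leqnSn n) k) = Some k.
  rewrite -[RHS](liftK (ord_max : 'I_n.+1)); congr unlift.
  by apply: val_inj; rewrite /= /bump leqNgt ltn_ord.
rewrite ltnS leq_eqVlt big_ord_recr /= /e' /b' unlift_none /=.
case: (eqVneq m n) => [-> _|mn /= lt_mn].
  under eq_bigr do rewrite liftE /=.
  by rewrite scale1r addrC subrK.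
under eq_bigr do rewrite liftE /=.
by rewrite scale0r addr0 gE.
Qed.

End Orthogonality.

(** * Finitely supported sums as sums over lists *)

Lemma fsum_seq (V : nmodType) (I : choiceType) (s : seq I) (F : I -> V) :
  uniq s -> (forall i, i \notin s -> F i = 0) ->
  \sum_(i \in [set: I]) F i = \sum_(i <- s) F i.
Proof.
move=> us F0; rewrite (fsbigE s) //; last by move=> i _; exact: F0.
by apply: eq_bigl => i; rewrite in_setT.
Qed.

Lemma sum_iota (V : nmodType) n (F : nat -> V) :
  \sum_(i <- iota 0 n) F i = \sum_(i < n) F i.
Proof. by rewrite -(big_mkord xpredT) /index_iota subn0. Qed.

Section FiniteSums.
Variables (K : numFieldType) (H : normedModType K).

(** The same [A] serves on both sides. An arbitrary [c] is truncated to zero outside [s n];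
    conversely, a finite support lies in some [s n]. *)
Lemma riesz_fischer_seq (I : countType) (f : I -> H) (s : nat -> seq I) :
  (forall n, uniq (s n)) ->
  (forall r : seq I, exists n, {subset r <= s n}) ->
  riesz_fischer f <-> exists2 A : K, 0 < A &
    forall n (c : I -> K),
      A * (\sum_(i <- s n) `|c i| ^+ 2) <= `|\sum_(i <- s n) c i *: f i| ^+ 2.
Proof.
move=> us s_cofinal; split=> -[A A0 fA]; exists A => //.
  move=> n c; pose c' i := if i \in s n then c i else 0.
  have c'0 i : i \notin s n -> c' i = 0 by rewrite /c' => /negbTE ->.
  have c'fin : finite_set [set i | c' i != 0].
    apply: (sub_finite_set _ (finite_seq (s n))) => i /=.
    by apply: contraNT => /c'0 ->.
  have := fA c' c'fin.
  rewrite (fsum_seq (us n)) => [|i /c'0 ->]; last by rewrite normr0 expr0n.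
  rewrite (fsum_seq (us n)) => [|i /c'0 ->]; last by rewrite scale0r.
  by under eq_big_seq do rewrite /c' ifT //;
     under [X in `|X|]eq_big_seq do rewrite /c' ifT //.
move=> c /finite_seqP[r rE].
have [n rn] := s_cofinal r.
have c0 i : i \notin s n -> c i = 0.
  apply: contraNeq => ci; apply: rn.
  by have : [set i | c i != 0] i by []; rewrite rE.
rewrite (fsum_seq (us n)) => [|i /c0 ->]; last by rewrite normr0 expr0n.
by rewrite (fsum_seq (us n)) => [|i /c0 ->] //; rewrite scale0r.
Qed.

(** Coefficients on [J] are carried along [h] and extended by zero, which changes neither sum. This
    extracts one row or one column of a doubly indexed family. *)
Lemma riesz_fischer_comp_inj (I J : countType) (h : J -> I) (f : I -> H) :
  riesz_fischer f -> injective h -> riesz_fischer (fun j => f (h j)).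
Proof.
move=> [A A0 fA] hI; exists A => // c cfin.
pose c' i := if pselect (exists j, h j = i) is left hi then c (projT1 (cid hi))
             else 0.
have c'h j : c' (h j) = c j.
  rewrite /c'; case: pselect => [hj|[]]; last by exists j.
  by congr c; apply: hI; exact: projT2 (cid hj).
have c'0 i : (~` range h) i -> c' i = 0.
  by rewrite /c'; case: pselect => // -[j hj] []; exists j.
have c'fin : finite_set [set i | c' i != 0].
  apply: (sub_finite_set _ (finite_image h cfin)) => i /= c'i.
  have [[j _ hj]|/c'0 ci0] := pselect (range h i); last by rewrite ci0 eqxx in c'i.
  by exists j => //=; rewrite -c'h hj.
(* Stated for a general [F] so as to serve both the sum of squares and the linear combination. *)
have sumE (V : nmodType) (F : I -> V) : (forall i, c' i = 0 -> F i = 0) ->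
    \sum_(i \in [set: I]) F i = \sum_(j \in [set: J]) F (h j).
  move=> F0; rewrite -(@fsbig_image _ _ _ _ _ [set: J] h F (in2W hI)).
  by apply/esym/fsbig_widen => // i [_ /c'0 /F0].
have := fA c' c'fin.
rewrite sumE => [|i ->]; last by rewrite normr0 expr0n.
rewrite sumE => [|i ->]; last by rewrite scale0r.
by under eq_fsbigr do rewrite c'h; under [X in `|X|]eq_fsbigr do rewrite c'h.
Qed.

Lemma subset_iota (r : seq nat) : exists n, {subset r <= iota 0 n}.
Proof.
exists (\max_(i <- r) i).+1 => i ir.
by rewrite mem_iota /= ltnS (@leq_bigmax_seq _ r xpredT id).
Qed.

Lemma riesz_fischer_nat (f : nat -> H) :
  riesz_fischer f <-> exists2 A : K, 0 < A &
    forall n (c : nat -> K),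
      A * (\sum_(i < n) `|c i| ^+ 2) <= `|\sum_(i < n) c i *: f i| ^+ 2.
Proof.
apply: (iff_trans (riesz_fischer_seq f (iota_uniq 0) subset_iota)).
by split=> -[A A0 fA]; exists A => // n c; move: (fA n c); rewrite !sum_iota.
Qed.

(** Square blocks of indices are enough, since any finite set of pairs lies in one. *)
Lemma riesz_fischer_nat2 (f : nat * nat -> H) :
  riesz_fischer f <-> exists2 A : K, 0 < A &
    forall n (c : nat * nat -> K),
      A * (\sum_(i < n) \sum_(j < n) `|c (i : nat, j : nat)| ^+ 2) <=
      `|\sum_(i < n) \sum_(j < n) c (i : nat, j : nat) *: f (i : nat, j : nat)|
        ^+ 2.
Proof.
pose s n := [seq (i, j) | i <- iota 0 n, j <- iota 0 n].
have us n : uniq (s n) by apply: allpairs_uniq; rewrite ?iota_uniq // => -[? ?] [].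
have s_cofinal (r : seq (nat * nat)) : exists n, {subset r <= s n}.
  (* A single [n] exceeding both coordinates of every pair. *)
  have [n rn] := subset_iota (unzip1 r ++ unzip2 r).
  exists n => p pr; apply/allpairsP; exists p; split; last by case: p {pr}.
    by apply: rn; rewrite mem_cat map_f.
  by apply: rn; rewrite mem_cat orbC map_f.
have sE n (V : nmodType) (F : nat * nat -> V) :
    \sum_(p <- s n) F p = \sum_(i < n) \sum_(j < n) F (i : nat, j : nat).
  by rewrite big_allpairs sum_iota; apply: eq_bigr => i _; rewrite sum_iota.
apply: (iff_trans (riesz_fischer_seq f us s_cofinal)).
by split=> -[A A0 fA]; exists A => // n c; move: (fA n c); rewrite !sE.
Qed.

End FiniteSums.

(** * Lower bounds for simple tensors *)

Section Tensor.
Variables (K : numFieldType) (conj : involutive_rmorphism K).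
Variables (H1 H2 : hilbertType conj) (H12 : hilbertTensor H1 H2).

Lemma tens_suml I (r : seq I) (P : pred I) (F : I -> H1) y :
  tens H12 (\sum_(i <- r | P i) F i) y = \sum_(i <- r | P i) tens H12 (F i) y.
Proof. by rewrite /tens linear_sumlz linear_sum. Qed.

Lemma tens_sumr I (r : seq I) (P : pred I) (F : I -> H2) x :
  tens H12 x (\sum_(i <- r | P i) F i) = \sum_(i <- r | P i) tens H12 x (F i).
Proof. by rewrite /tens linear_sumr linear_sum. Qed.

Lemma tensZl a x y : tens H12 (a *: x) y = a *: tens H12 x y.
Proof. by rewrite /tens linearZl_LR /= linearZ. Qed.

Lemma tensZr a x y : tens H12 x (a *: y) = a *: tens H12 x y.
Proof. by rewrite /tens linearZr_LR /= linearZ. Qed.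

Lemma inner_tens x x' y y' :
  inner (tens H12 x y) (tens H12 x' y') = inner x x' * inner y y'.
Proof. by rewrite /tens embed_isometric algdot_tens. Qed.

Lemma sqr_norm_tens x y : `|tens H12 x y| ^+ 2 = `|x| ^+ 2 * `|y| ^+ 2.
Proof. by rewrite !sqr_norm_inner inner_tens. Qed.

Lemma riesz_fischer_tens (f : nat -> H1) (g : nat -> H2) :
  riesz_fischer f -> riesz_fischer g ->
  riesz_fischer (fun p : nat * nat => tens H12 (f p.1) (g p.2)).
Proof.
move=> /riesz_fischer_nat[A A0 fA] /riesz_fischer_nat[B B0 gB].
apply/riesz_fischer_nat2; exists (A * B) => [|n c]; first exact: mulr_gt0.
have [e [b [ortho gE]]] := gram_schmidt g n.
pose d (i : nat) k := \sum_(j < n) c (i, j : nat) * b j k.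
have sumgE (i : nat) : \sum_(j < n) c (i, j : nat) *: g j = \sum_k d i k *: e k.
  under eq_bigr => j _ do rewrite gE // scaler_sumr.
  rewrite exchange_big; apply: eq_bigr => k _ /=; rewrite scaler_suml.
  by apply: eq_bigr => j _; rewrite scalerA.
(* Collecting terms by [e k] leaves simple tensors that are mutually orthogonal, because their right
   factors are. *)
have -> : \sum_(i < n) \sum_(j < n) c (i : nat, j : nat) *: tens H12 (f i) (g j)
    = \sum_k tens H12 (\sum_(i < n) d i k *: f i) (e k).
  under [RHS]eq_bigr do rewrite tens_suml.
  rewrite [RHS]exchange_big; apply: eq_bigr => i _ /=.
  under eq_bigr do rewrite -tensZr.
  rewrite -tens_sumr sumgE tens_sumr; apply: eq_bigr => k _.
  by rewrite tensZr tensZl.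
rewrite sqr_norm_sum => [|k l kl]; last by rewrite inner_tens ortho // mulr0.
under [leRHS]eq_bigr do rewrite sqr_norm_tens.
(* The bound for [g] is applied to each row of [c], giving the first inequality below. *)
apply: (@le_trans _ _
    (A * \sum_(i < n) `|\sum_(j < n) c (i : nat, j : nat) *: g j| ^+ 2)).
  rewrite -mulrA ler_pM2l // mulr_sumr; apply: ler_sum => i _.
  exact: (gB n (fun j => c (i : nat, j))).
(* Expanding in the [e k] and exchanging the sums lets the bound for [f] apply to each column
   [d^~ k], with nonnegative weight [|e k|^2]; a vanishing [e k] does no harm. *)
under [X in _ * X <= _]eq_bigr do rewrite sumgE sqr_norm_sumZ //.
rewrite exchange_big mulr_sumr; apply: ler_sum => k _ /=.
rewrite -mulr_suml mulrA ler_wpM2r ?exprn_ge0 //.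
exact: (fA n (d^~ k)).
Qed.

(** Tensoring with the fixed [y] multiplies squared norms by [|y|^2], so the bound for [f] is
    [A / |y|^2]. *)
Lemma riesz_fischer_tensl (f : nat -> H1) (y : H2) :
  riesz_fischer (fun i => tens H12 (f i) y) -> riesz_fischer f.
Proof.
move=> /riesz_fischer_nat[A A0 fyA].
have bound n (c : nat -> K) : A * (\sum_(i < n) `|c i| ^+ 2) <=
    `|\sum_(i < n) c i *: f i| ^+ 2 * `|y| ^+ 2.
  rewrite -sqr_norm_tens tens_suml; under [X in `|X|]eq_bigr do rewrite tensZl.
  exact: fyA.
(* If [y] were 0, the single coefficient 1 would give [A <= 0]. *)
have y0 : 0 < `|y| ^+ 2.
  rewrite exprn_gt0 // normr_gt0; apply: contraTneq A0 => y0.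
  have := bound 1%N (fun=> 1).
  by rewrite y0 normr0 expr0n mulr0 big_ord1 normr1 expr1n mulr1 => /le_gtF ->.
apply/riesz_fischer_nat; exists (A / `|y| ^+ 2) => [|n c]; first exact: divr_gt0.
by rewrite mulrAC ler_pdivrMr.
Qed.

Lemma riesz_fischer_tensr (x : H1) (g : nat -> H2) :
  riesz_fischer (fun i => tens H12 x (g i)) -> riesz_fischer g.
Proof.
move=> /riesz_fischer_nat[A A0 xgA].
have bound n (c : nat -> K) : A * (\sum_(i < n) `|c i| ^+ 2) <=
    `|x| ^+ 2 * `|\sum_(i < n) c i *: g i| ^+ 2.
  rewrite -sqr_norm_tens tens_sumr; under [X in `|X|]eq_bigr do rewrite tensZr.
  exact: xgA.
have x0 : 0 < `|x| ^+ 2.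
  rewrite exprn_gt0 // normr_gt0; apply: contraTneq A0 => x0.
  have := bound 1%N (fun=> 1).
  by rewrite x0 normr0 expr0n mul0r big_ord1 normr1 expr1n mulr1 => /le_gtF ->.
apply/riesz_fischer_nat; exists (A / `|x| ^+ 2) => [|n c]; first exact: divr_gt0.
by rewrite mulrAC ler_pdivrMr // [leRHS]mulrC.
Qed.

End Tensor.

Theorem theorem3p4 (R : realType) (K : numFieldType)
    (conj : involutive_rmorphism K) (hK : real_or_complex R conj)
    (H1 H2 : hilbertType conj) (sep1 : separable H1) (sep2 : separable H2)
    (H12 : hilbertTensor H1 H2) (f : nat -> H1) (g : nat -> H2) :
  riesz_fischer (fun p : nat * nat => tens H12 (f p.1) (g p.2)) <->
  riesz_fischer f /\ riesz_fischer g.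
Proof.
split=> [fg|[]]; last exact: riesz_fischer_tens.
split.
  (* The pairs [(i, 0)] recover [f]; symmetrically, the pairs [(0, j)] recover [g] below. *)
  apply: (@riesz_fischer_tensl _ _ _ _ H12 _ (g 0%N)).
  by apply: (riesz_fischer_comp_inj (h := fun i => (i, 0%N)) fg) => i j [].
apply: (@riesz_fischer_tensr _ _ _ _ H12 (f 0%N)).
by apply: (riesz_fischer_comp_inj (h := fun j => (0%N, j)) fg) => i j [].
Qed.
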